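(* Let $G$ be a locally compact group and let $H$ be an open subgroup of $G$ such that $(G,H)$ is a Hecke pair (so that $(G,H)$ is a discrete Hecke pair). Let $\Gamma$ be a closed subgroup of $G$ containing $H$. If the pair $(G,H)$ is amenable, then the pair $(\Gamma,H)$ is amenable too.
   Context: Hecke pairs. Let $H$ be a subgroup of a group $G$. The pair $(G,H)$ is called a Hecke pair (and $H$ a Hecke subgroup of $G$) if every double coset $HxH$, $x\in G$, is a union of finitely many left cosets of $H$. If $G$ is a locally compact group and $H$ is an open subgroup of $G$ which is also a Hecke subgroup of $G$, then $(G,H)$ is called a discrete Hecke pair (the homogeneous space $H\backslash G$ is then discrete; $G$ itself need not be discrete). Amenability of pairs. Let $H$ be a closed subgroup of a locally compact group $G$. The pair $(G,H)$ is called amenable if it has the following fixed point property: whenever $G$ acts continuously on a compact convex subset $Q$ of a locally convex topological vector space by affine transformations and the restriction of this action to $H$ has a fixed point in $Q$, then there exists a point of $Q$ fixed by the action of $G$. Amenability of the pair $(\Gamma,H)$ is defined in the same way, with the locally compact group $\Gamma$ (carrying the subspace topology from $G$) in place of $G$. *)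

(* Defs.v *)
From HB Require Import structures.
From mathcomp Require Import all_boot all_order all_algebra.
From mathcomp Require Import all_classical all_reals all_analysis.

Set Implicit Arguments.
Unset Strict Implicit.
Unset Printing Implicit Defensive.

Local Open Scope classical_set_scope.
Local Open Scope convex_scope.
Local Open Scope group_scope.

HB.mixin Record isTopologicalGroup G & Topological G & Group G := {
  mulg_continuous : continuous (fun p : G * G => p.1 * p.2) ;
  invg_continuous : continuous (fun x : G => x^-1)
}.

#[short(type="topologicalGroupType")]
HB.structure Definition TopologicalGroup :=
  {G of Topological G & Group G & isTopologicalGroup G}.

(* Locally compact groups are Hausdorff by convention. *)
Definition locally_compact_group (G : topologicalGroupType) : Prop :=
  hausdorff_space G /\ locally_compact [set: G].

(* The subgroup K of G as a topological group, with the subspace topology. *)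
Definition subgroup_type (G : topologicalGroupType) (K : groupClosed G) : Type :=
  {x : G | x \in K}.

Section SubgroupType.
Context (G : topologicalGroupType) (K : groupClosed G).

Local Notation KT := (subgroup_type K).

HB.instance Definition _ := [isSub of KT for @sval G (fun x => x \in K)].
HB.instance Definition _ := [Choice of KT by <:].

Let group_closedK : group_closed K.
Proof. by split; [exact: gpred1|exact: gpredF]. Qed.

HB.instance Definition _ :=
  SubChoice_isSubGroup.Build G (fun x => x \in K) KT group_closedK.

HB.instance Definition _ :=
  Topological.copy KT (initial_topology (val : KT -> G)).

Let val_continuous : continuous (val : KT -> G).
Proof. exact: (@initial_continuous KT G val). Qed.

Let into_continuous (T : topologicalType) (f : T -> KT) :
  continuous (val \o f) -> continuous f.
Proof.
move=> cf; apply/continuousP => _ [B oB <-].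
by move/continuousP: cf => /(_ B oB); rewrite comp_preimage.
Qed.

Let mulK_continuous : continuous (fun p : KT * KT => p.1 * p.2).
Proof.
apply: into_continuous => -[x y].
have -> : val \o (fun p : KT * KT => p.1 * p.2) =
    (fun p : G * G => p.1 * p.2) \o (fun p : KT * KT => (val p.1, val p.2)).
  by apply/funext => p; exact: valM.
apply: continuous_comp; last exact: mulg_continuous.
by apply: cvg_pair; apply: continuous_comp => //=;
  [exact: cvg_fst|exact: val_continuous|exact: cvg_snd|exact: val_continuous].
Qed.

Let invK_continuous : continuous (fun x : KT => x^-1).
Proof.
apply: into_continuous => x.
have -> : val \o (fun x : KT => x^-1) = (fun x : G => x^-1) \o val.
  by apply/funext => y; exact: gmulfV.
by apply: continuous_comp; [exact: val_continuous|exact: invg_continuous].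
Qed.

HB.instance Definition _ :=
  isTopologicalGroup.Build KT mulK_continuous invK_continuous.

End SubgroupType.

(* The intersection of H with K, as a subgroup of K. *)
Definition subgroup_in (G : topologicalGroupType) (K H : groupClosed G) :
  {pred subgroup_type K} := [pred x | val x \in H].
Arguments subgroup_in {G} K H _.

Section SubgroupIn.
Context (G : topologicalGroupType) (K H : groupClosed G).

Let mulP : mulg_closed (subgroup_in K H).
Proof. by move=> x y; rewrite !inE valM; exact: gpredM. Qed.

Let oneP : 1 \in subgroup_in K H.
Proof. by rewrite inE val1; exact: gpred1. Qed.

Let invP : invg_closed (subgroup_in K H).
Proof. by move=> x; rewrite !inE gmulfV gpredV. Qed.

HB.instance Definition _ := isMulClosed.Build _ (subgroup_in K H) mulP.
HB.instance Definition _ := isMul1Closed.Build _ (subgroup_in K H) oneP.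
HB.instance Definition _ := isInvClosed.Build _ (subgroup_in K H) invP.

End SubgroupIn.

Definition left_coset (G : groupType) (H : groupClosed G) (x : G) : set G :=
  [set x * h | h in [set` H]].

Definition double_coset (G : groupType) (H : groupClosed G) (x : G) : set G :=
  [set h * x * k | h in [set` H] & k in [set` H]].

Definition hecke_pair (G : groupType) (H : groupClosed G) : Prop :=
  forall x : G, exists2 A : set G, finite_set A &
    double_coset H x = \bigcup_(y in A) left_coset H y.

(* [act] is a total function on E, but only its restriction to Q is
   constrained; continuity is joint continuity on the product of G and Q. *)
Definition continuous_affine_action (R : realType) (G : topologicalGroupType)
    (E : tvsType R) (Q : set (convex_lmodType E)) (act : G -> E -> E) : Prop :=
  [/\ forall g x, Q x -> Q (act g x),
      forall x, Q x -> act 1 x = x,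
      forall g h x, Q x -> act (g * h) x = act g (act h x),
      forall g (t : {i01 R}) (x y : convex_lmodType E), Q x -> Q y ->
        act g (x <| t |> y) =
        ((act g x : convex_lmodType E) <| t |> (act g y : convex_lmodType E))
    & {within [set: G] `*` (Q : set E), continuous (fun p : G * E => act p.1 p.2)}].

(* Locally convex spaces are real and Hausdorff; a [tvsType] is locally convex
   but need not be Hausdorff, and without the separation hypothesis every
   convex set with the indiscrete topology would qualify as Q. *)
Definition amenable_pair (R : realType) (G : topologicalGroupType)
    (H : groupClosed G) : Prop :=
  forall (E : tvsType R) (Q : set E) (act : G -> E -> E),
    hausdorff_space E -> compact Q -> convex_set (Q : set (convex_lmodType E)) ->
    continuous_affine_action Q act ->
    (exists2 x, Q x & forall h, h \in H -> act h x = x) ->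
    exists2 x, Q x & forall g, act g x = x.

(* Main.v *)
(* Let Gamma act on Q with an H-fixed point x0. Then G acts by left translation
   on the compact convex set of maps f : G -> Q with f (g k) = k^-1 (f g) for k
   in Gamma, and a G-fixed map is constant, its value being fixed by Gamma. An
   H-fixed map amounts to the choice, for each double coset H r Gamma, of a
   point of Q fixed by the intersection of Gamma and r^-1 H r; by the Hecke
   condition the orbit of x0 under that group is finite, and its mean is such
   a point. *)
Require Import Defs.
From HB Require Import structures.
From mathcomp Require Import all_boot all_order all_algebra.
From mathcomp Require Import all_classical all_reals all_analysis.

Set Implicit Arguments.
Unset Strict Implicit.
Unset Printing Implicit Defensive.

Import Order.TTheory GRing.Theory Num.Theory.

Local Open Scope classical_set_scope.

(* An alias of [I -> E], as arrow types carry no canonical topology. *)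
Definition function_space (I E : Type) : Type := prod_topology (fun _ : I => E).

(** * Maps into a locally convex space, with the topology of pointwise convergence *)

Section FunctionSpace.
Local Open Scope ring_scope.
Context (R : realType) (I : Type) (E : tvsType R).
Local Notation F := (function_space I E).

HB.instance Definition _ := GRing.Lmodule.copy F (I -> E).
HB.instance Definition _ := Uniform.copy F (prod_topology (fun _ : I => E)).

Lemma cvg_function_space (Fi : set_system F) (f : F) : Filter Fi ->
  (forall i, (fun h : F => h i) @ Fi --> f i) -> Fi --> f.
Proof.
move=> FF cf; apply/cvg_sup => i U [_ [[W oW <-] Wf]] /filterS; apply.
by apply: (cf i); exact: open_nbhs_nbhs.
Qed.

Lemma eval_at_continuous (i : I) : continuous (fun h : F => h i).
Proof. by move=> f; exact: (@proj_continuous {classic I} (fun=> E) i f). Qed.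

Lemma function_space_continuous (T : topologicalType) (f : T -> F) :
  (forall i, continuous (fun t => f t i)) -> continuous f.
Proof. by move=> cf t; apply: cvg_function_space => i; exact: cf. Qed.

Let addc : continuous (fun x : F * F => x.1 + x.2).
Proof.
apply: function_space_continuous => i [f g].
apply: (@continuous_comp _ _ _ (fun p : F * F => (p.1 i, p.2 i))
  (fun p : E * E => p.1 + p.2)); last exact: add_continuous.
apply: cvg_pair.
  apply: (@continuous_comp _ _ _ fst (fun h : F => h i)).
    exact: cvg_fst.
  exact: eval_at_continuous.
apply: (@continuous_comp _ _ _ snd (fun h : F => h i)); first exact: cvg_snd.
exact: eval_at_continuous.
Qed.

Let scalec : continuous (fun z : R^o * F => z.1 *: z.2).
Proof.
apply: function_space_continuous => i [a f].
apply: (@continuous_comp _ _ _ (fun p : R^o * F => (p.1, p.2 i))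
  (fun p : R^o * E => p.1 *: p.2)); last exact: scale_continuous.
apply: (@cvg_pair _ _ _ _ (nbhs (a : R^o)) (nbhs (f i))); first exact: cvg_fst.
apply: (@continuous_comp (R^o * F)%type F E snd (fun h => h i) (a, f)).
  exact: cvg_snd.
exact: eval_at_continuous.
Qed.

Let lconv : exists2 B : set_system F,
  (forall b, b \in B -> convex_set b) & basis B.
Proof.
have [C Ccvx [Copen Cbasis]] := @locally_convex R E.
exists [set b | open b /\ convex_set (b : set (convex_lmodType F))].
  by move=> b /set_mem[].
split=> [b []//|f].
(* Finite intersections of open convex sets are open and convex, so those containing [f] generate a
   filter. Its convergence to [f] can then be tested one coordinate at a time, on preimages of basic
   convex sets of [E]. *)
have filt : Filter (filter_from
    [set U | (open U /\ convex_set (U : set (convex_lmodType F))) /\ U f] id).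
  apply: filter_from_filter.
    by exists setT; split=> //; split; [exact: openT|move=> *; rewrite inE].
  move=> U V [[oU cU] Uf] [[oV cV] Vf]; exists (U `&` V) => //.
  split=> //; split; first exact: openI.
  move=> x y l /set_mem[Ux Vx] /set_mem[Uy Vy]; apply/mem_set; split.
    by apply/set_mem/cU; exact/mem_set.
  by apply/set_mem/cV; exact/mem_set.
apply: cvg_function_space => i W /Cbasis[B [CB Bfi] BW].
exists ((fun h : F => h i) @^-1` B) => /=; last by move=> h /BW.
split=> //; split.
  apply: open_comp; last exact: Copen.
  by move=> h _; exact: eval_at_continuous.
move=> x y l /set_mem Bx /set_mem By; apply/mem_set.
by apply/set_mem/(Ccvx _ (mem_set CB)); exact/mem_set.
Qed.

HB.instance Definition _ :=
  PreTopologicalNmodule_isTopologicalNmodule.Build F addc.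
HB.instance Definition _ :=
  TopologicalNmodule_isTopologicalLmodule.Build R F scalec.
HB.instance Definition _ := Uniform_isTvs.Build R F lconv.

End FunctionSpace.

(** * Means of finite sequences in a convex set *)

Definition mean (R : realType) (E : lmodType R) (s : seq E) : E :=
  ((size s)%:R^-1 *: \sum_(x <- s) x)%R.

Section Mean.
Local Open Scope convex_scope.
Local Open Scope ring_scope.
Context (R : realType) (E : lmodType R) (Q : set (convex_lmodType E)).
Hypothesis cQ : convex_set Q.

(** The weight is 1/(n+2). It is chosen before [x] and [s], so that a sequence and its image under
    an affine map are split with the same [t]. *)
Lemma mean_cons (n : nat) : exists t : {i01 R}, forall (x : E) (s : seq E),
  size s = n.+1 ->
  mean (x :: s) = (x : convex_lmodType E) <| t |> (mean s).
Proof.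
have t0 : 0 <= n.+2%:R^-1 :> R by rewrite invr_ge0.
have t1 : n.+2%:R^-1 <= 1 :> R by rewrite invf_le1// ler1n.
exists (Itv01 t0 t1) => x s sn.
rewrite /mean big_cons /= sn scalerDr; congr (_ + _).
rewrite scalerA; congr (_ *: _).
have n1 : n.+1%:R != 0 :> R by rewrite pnatr_eq0.
have n2 : n.+2%:R != 0 :> R by rewrite pnatr_eq0.
apply: (mulIf n1); rewrite mulfVK//; apply: (mulfI n2).
rewrite mulrA mulfV// mul1r mulrBr mulr1 mulfV//.
by rewrite -[X in _ = _ - X]/(1%:R) -natrB// subSS subn0.
Qed.

Lemma mean_seq1 (x : E) : mean [:: x] = x.
Proof. by rewrite /mean big_seq1 invr1 scale1r. Qed.

Lemma mean_convex (s : seq E) :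
  s != [::] -> {in s, forall x, Q x} -> Q (mean s).
Proof.
elim: s => [//|x [|y s] IH] _ Qs.
  by rewrite mean_seq1; apply: Qs; rewrite mem_head.
have [t ->//] := mean_cons (size s).
apply/set_mem/cQ; apply/mem_set; first by apply: Qs; rewrite mem_head.
by apply: IH => // z zs; apply: Qs; rewrite inE zs orbT.
Qed.

Lemma mean_affine (a : E -> E) (s : seq E) :
  (forall (t : {i01 R}) (x y : convex_lmodType E), Q x -> Q y ->
    a (x <| t |> y) = (a x : convex_lmodType E) <| t |> a y) ->
  s != [::] -> {in s, forall x, Q x} -> a (mean s) = mean (map a s).
Proof.
move=> aff; elim: s => [//|x [|y s] IH] _ Qs; first by rewrite /= !mean_seq1.
have Qx : Q x by apply: Qs; rewrite mem_head.
have Qys : {in y :: s, forall z, Q z}.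
  by move=> z zs; apply: Qs; rewrite inE zs orbT.
have [t mt] := mean_cons (size s).
rewrite (mt x (y :: s))// map_cons (mt (a x) (map a (y :: s))) ?size_map//.
by rewrite -(IH _ Qys)//; apply: aff; [exact: Qx|exact: mean_convex].
Qed.

End Mean.

(** * Fixed points from finite orbits *)

Section FiniteOrbit.
Local Open Scope group_scope.
Context (R : realType) (G : topologicalGroupType) (E : tvsType R).
Context (Q : set (convex_lmodType E)) (act : G -> E -> E).
Hypotheses (cQ : convex_set Q) (actQ : continuous_affine_action Q act).

Lemma finite_orbit_fixed (K : groupClosed G) (x : E) : Q x ->
  finite_set [set act k x | k in [set` K]] ->
  exists2 q, Q q & forall k, k \in K -> act k q = q.
Proof.
case: actQ => stabQ act1 actM aff _ Qx /finite_seqP[s0 s0E].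
(* Repetitions are removed so that every orbit point gets the same weight. *)
pose s := undup s0.
have sP y : y \in s <-> exists2 k, k \in K & act k x = y.
  rewrite mem_undup; have -> : (y \in s0) = ([set` s0] y) :> Prop by [].
  by rewrite -s0E; split => -[k]; exists k.
have Qs : {in s, forall y, Q y} by move=> y /sP[k _ <-]; exact: stabQ.
have s_neq0 : s != [::].
  have : x \in s by apply/sP; exists 1; [exact: gpred1|exact: act1].
  by apply: contraTneq => ->.
exists (mean s); first exact: mean_convex.
move=> k kK; rewrite (mean_affine cQ)//; last exact: aff.
have actK y : y \in s -> act k^-1 (act k y) = y.
  by move=> ys; rewrite -actM ?mulVg ?act1//; exact: Qs.
have uks : uniq (map (act k) s).
  rewrite map_inj_in_uniq ?undup_uniq// => y z ys zs /(congr1 (act k^-1)).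
  by rewrite !actK.
have ks : {subset map (act k) s <= s}.
  move=> _ /mapP[_ /sP[j jK <-] ->]; apply/sP; exists (k * j).
    exact: gpredM.
  by rewrite actM.
(* An injective map of a finite set into itself is a permutation, so [k] only reorders the sum. *)
have [_ kse] := uniq_min_size uks ks (eq_leq (esym (size_map _ _))).
rewrite /mean size_map; congr (_ *: _)%R.
by apply/perm_big/uniq_perm; [exact: uks|exact: undup_uniq|exact: kse].
Qed.

End FiniteOrbit.

(** * Conjugate subgroups and the Hecke condition *)

Section ConjugateSubgroup.
Local Open Scope group_scope.
Context (G : topologicalGroupType) (Gamma H : groupClosed G) (g : G).

(** This is the stabilizer in [Gamma] of the coset H g under right multiplication. *)
Definition conj_subgroup : {pred subgroup_type Gamma} :=
  [pred k | g * val k * g^-1 \in H].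

Let mulP : mulg_closed conj_subgroup.
Proof.
move=> x y; rewrite !inE valM => xH yH.
have -> : g * (val x * val y) * g^-1 = (g * val x * g^-1) * (g * val y * g^-1).
  by rewrite !mulgA mulgVK.
exact: gpredM.
Qed.

Let oneP : 1 \in conj_subgroup.
Proof. by rewrite inE val1 mulg1 mulgV; exact: gpred1. Qed.

Let invP : invg_closed conj_subgroup.
Proof.
move=> x; rewrite !inE gmulfV => xH.
have -> : g * (val x)^-1 * g^-1 = (g * val x * g^-1)^-1.
  by rewrite !invgM invgK mulgA.
by rewrite gpredV.
Qed.

HB.instance Definition _ := isMulClosed.Build _ conj_subgroup mulP.
HB.instance Definition _ := isMul1Closed.Build _ conj_subgroup oneP.
HB.instance Definition _ := isInvClosed.Build _ conj_subgroup invP.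

End ConjugateSubgroup.

Arguments conj_subgroup {G} Gamma H g _.

Section Hecke.
Local Open Scope group_scope.
Context (R : realType) (G : topologicalGroupType) (H Gamma : groupClosed G).
Hypothesis heckeH : hecke_pair H.
Context (E : tvsType R) (Q : set (convex_lmodType E)).
Context (act : subgroup_type Gamma -> E -> E).
Hypothesis actQ : continuous_affine_action Q act.

(** If g k and g k' lie in the same left coset of [H], then k^-1 k' is in [H] and fixes [x], so k
    and k' send [x] to the same point. The orbit thus has at most one point for each left coset in H
    g H. *)
Lemma hecke_finite_orbit (x : E) (g : G) : Q x ->
  (forall h, h \in subgroup_in Gamma H -> act h x = x) ->
  finite_set [set act k x | k in [set` conj_subgroup Gamma H g]].
Proof.
case: actQ => _ _ actM _ _ Qx xH; have [A finA AE] := heckeH g.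
pose P y := [set k : subgroup_type Gamma |
  k \in conj_subgroup Gamma H g /\ left_coset H y (g * val k)].
apply: (sub_finite_set _ (finite_image (fun y => act (xget 1 (P y)) x) finA)).
move=> _ [k kK <-].
(* Here g k = (g k g^-1) g is already in H g. *)
have : double_coset H g (g * val k).
  exists (g * val k * g^-1) => //; exists 1; first exact: gpred1.
  by rewrite mulg1 mulgVK.
rewrite AE => -[y Ay ygk]; exists y => //.
have [|_] := @xgetPex _ 1 (P y); first by exists k.
move: ygk (xget _ _) => -[h1 h1H e1] k' [h2 h2H e2].
rewrite -[k'](mulVKg k) actM ?(xH (k^-1 * k'))// inE valM gmulfV.
have -> : (val k)^-1 * val k' = h1^-1 * h2.
  rewrite -[val k](mulKg g) -[val k'](mulKg g) -e1 -e2.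
  by rewrite !invgM invgK !mulgA mulgK mulgVK.
by apply: gpredM => //; rewrite gpredV.
Qed.

End Hecke.

Lemma continuousMg (T : topologicalType) (G : topologicalGroupType)
    (f h : T -> G) :
  continuous f -> continuous h -> continuous (fun t => f t * h t)%g.
Proof.
move=> cf ch t.
apply: (@continuous_comp T (G * G)%type G (fun t => (f t, h t))
  (fun p => p.1 * p.2)%g); last exact: mulg_continuous.
exact: (cvg_pair (cf t) (ch t)).
Qed.

(** * The action of [G] induced from the action of [Gamma] *)

Section Induced.
Local Open Scope convex_scope.
Local Open Scope group_scope.
Context (R : realType) (G : topologicalGroupType) (H Gamma : groupClosed G).
Hypothesis HGamma : {subset H <= Gamma}.
Context (E : tvsType R) (Q : set E).
Context (act : subgroup_type Gamma -> E -> E).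
Hypothesis actQ : continuous_affine_action (Q : set (convex_lmodType E)) act.

(** Only pointwise conditions are imposed, no continuity in g, so that the set can be closed for
    pointwise convergence. *)
Definition induced_set : set (function_space G E) :=
  [set f | (forall g, Q (f g)) /\
    forall g (k : subgroup_type Gamma), f (g * val k) = act k^-1 (f g)].

Definition translate (g : G) (f : function_space G E) : function_space G E :=
  fun x => f (g^-1 * x).

Lemma act_continuous_within (k : subgroup_type Gamma) (y : E) : Q y ->
  (fun p : subgroup_type Gamma * E => act p.1 p.2) @
    within ([set: subgroup_type Gamma] `*` Q) (nbhs (k, y)) --> act k y.
Proof.
case: actQ => _ _ _ _ /subspace_continuousP cact Qy.
exact: (cact (k, y)).
Qed.

(** Since [act] is continuous only on the product of [Gamma] and [Q], [v] has to stay in [Q]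
    eventually. *)
Lemma cvg_act (T : Type) (F : set_system T) (FF : Filter F)
    (u : T -> subgroup_type Gamma) (v : T -> E) (k : subgroup_type Gamma)
    (y : E) :
  Q y -> u @ F --> k -> v @ F --> y -> (\forall t \near F, Q (v t)) ->
  (fun t => act (u t) (v t)) @ F --> act k y.
Proof.
move=> Qy uk vy Qv.
apply: (cvg_comp (fun t => (u t, v t)) _ _ (act_continuous_within (k := k) Qy)).
move=> W /(cvg_pair uk vy) /= FW.
have {}FW : \forall t \near F, True /\ Q (v t) -> W (u t, v t) := FW.
near=> t; suff : True /\ Q (v t) by near: t.
by split=> //; near: t.
Unshelve. all: by end_near.
Qed.

Lemma induced_convex : convex_set (Q : set (convex_lmodType E)) ->
  convex_set (induced_set : set (convex_lmodType (function_space G E))).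
Proof.
case: actQ => _ _ _ aff _ cQ f h l /set_mem[Qf ef] /set_mem[Qh eh].
apply/mem_set; split=> [g|g k].
  by apply/set_mem; apply: (cQ (f g) (h g) l); exact/mem_set.
rewrite -[LHS]/((f (g * val k) : convex_lmodType E) <| l |> h (g * val k)).
by rewrite ef eh -aff.
Qed.

(** The power of [Q] is compact by Tychonoff. The equivariance equations survive limits, as each
    [act k^-1] is continuous on [Q] and limits in [E] are unique. *)
Lemma induced_compact : hausdorff_space E -> compact Q -> compact induced_set.
Proof.
move=> hE cptQ; have closQ := compact_closed hE cptQ.
have cptQG : compact [set f : function_space G E | forall g, Q (f g)].
  exact: (@tychonoff G (fun=> E) (fun=> Q)).
apply: (subclosed_compact _ cptQG) => [|f []//].
rewrite /closed closureEcvg => f [F PF [Ff]] indF.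
have evF g : (fun h : function_space G E => h g) @ F --> f g.
  exact: (cvg_trans (cvg_app (fun h : function_space G E => h g) Ff)
            (@eval_at_continuous R G E g f)).
have FI : F induced_set by apply: indF.
have Qf g : Q (f g).
  by apply: (closed_cvg _ closQ _ _ (evF g)); apply: filterS FI => h [].
split=> // g k; apply: (cvg_unique hE (evF _)).
have : (fun h : function_space G E => act k^-1 (h g)) @ F --> act k^-1 (f g).
  apply: cvg_act => //; first exact: cvg_cst.
  by apply: filterS FI => h [].
apply: cvg_trans; apply: near_eq_cvg.
by apply: filterS FI => h [_ ->].
Qed.

(** The substantial clause is joint continuity: the point g^-1 x at which f is evaluated moves with
    g, and f is not assumed continuous. Openness of [H] makes up for this. *)
Lemma translate_action : open [set` H] ->
  continuous_affine_action
    (induced_set : set (convex_lmodType (function_space G E))) translate.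
Proof.
case: actQ => stabQ act1 _ _ _ oH; split.
- move=> g f [Qf ef]; split=> [x|x k]; first exact: Qf.
  by rewrite /translate mulgA ef.
- by move=> f _; apply/funext => x; rewrite /translate invg1 mul1g.
- by move=> g h f _; apply/funext => x; rewrite /translate invgM mulgA.
- by [].
apply/subspace_continuousP => -[g0 f0] [_ [Qf0 ef0]] /=.
set F := within _ _.
have FF : Filter F by exact: within_filter.
have Fn : F --> (g0, f0) by exact: cvg_within.
have F1 : (fun p : G * function_space G E => p.1) @ F --> g0.
  exact: (cvg_trans (cvg_app (fun p => p.1) Fn) cvg_fst).
have F2 : (fun p : G * function_space G E => p.2) @ F --> f0.
  exact: (cvg_trans (cvg_app (fun p => p.2) Fn) cvg_snd).
have FI : \forall p \near F, induced_set p.2.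
  by rewrite near_withinE; apply: nearW => p [].
apply: cvg_function_space => x.
suff : (fun p : G * function_space G E => p.2 (p.1^-1 * x)) @ F -->
    f0 (g0^-1 * x) by [].
(* For g near g0, v g lies in the open subgroup H and
   g^-1 * x = g0^-1 * x * (v g)^-1, so f (g^-1 * x) = act (v g) (f (g0^-1 * x))
   for f in the induced set: continuity follows from that of [act] at 1. *)
pose v (g : G) := x^-1 * g * g0^-1 * x.
have vF : (fun p : G * function_space G E => v p.1) @ F --> (1 : G).
  have -> : 1 = v g0 by rewrite /v mulgK mulVg.
  have cv : continuous v.
    apply: continuousMg; last exact: cst_continuous.
    apply: continuousMg; last exact: cst_continuous.
    by apply: continuousMg => [|y]; [exact: cst_continuous|exact: cvg_id].
  exact: (cvg_comp _ _ F1 (cv g0)).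
have vH : \forall p \near F, v p.1 \in H.
  by apply: (vF [set` H]); apply: open_nbhs_nbhs; split => //; exact: gpred1.
(* The default 1 is taken only where [v g] is outside [Gamma], which does not happen near [g0]. *)
pose w g : subgroup_type Gamma := insubd 1 (v g).
have vw g : v g \in H -> val (w g) = v g.
  by move=> /HGamma vG; rewrite insubdK.
have wF : (fun p : G * function_space G E => w p.1) @ F -->
    (1 : subgroup_type Gamma).
  move=> U [_ [[W oW <-] W1]] /filterS; apply.
  have vW : \forall p \near F, W (v p.1).
    by apply: (vF W); apply: open_nbhs_nbhs; split.
  suff : \forall p \near F, W (val (w p.1)) by [].
  by apply: filterS (filterI vW vH) => p [Wp Hp]; rewrite /= vw.
rewrite -[X in _ --> X]act1//.
have : (fun p : G * function_space G E => act (w p.1) (p.2 (g0^-1 * x))) @ F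
    --> act 1 (f0 (g0^-1 * x)).
  apply: cvg_act => //.
    exact: (cvg_comp _ _ F2 (@eval_at_continuous R G E (g0^-1 * x) f0)).
  by apply: filterS FI => p [].
apply: cvg_trans; apply: near_eq_cvg.
near=> p.
have [_ ep] : induced_set p.2 by near: p.
have vpH : v p.1 \in H by near: p.
have -> : p.1^-1 * x = g0^-1 * x * (v p.1)^-1.
  by rewrite /v !invgM !invgK !mulgA mulgK mulVg mul1g.
by rewrite -(vw _ vpH) -[w p.1 in LHS]invgK -ep gmulfV.
Unshelve. all: by end_near.
Qed.

End Induced.

(** * Maps fixed by [H] in the induced set *)

Section InducedFixedPoint.
Local Open Scope group_scope.
Context (R : realType) (G : topologicalGroupType) (H Gamma : groupClosed G).
Context (E : tvsType R) (Q : set E).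
Context (act : subgroup_type Gamma -> E -> E).
Hypothesis actQ : continuous_affine_action (Q : set (convex_lmodType E)) act.

(** On H r Gamma the map sends h r k to k^-1 q, with q the fixed point chosen for r. If h1 r k1 = h2
    r k2, then r k1 k2^-1 r^-1 = h1^-1 h2 is in [H], so k1 k2^-1 fixes q and the value does not
    depend on the decomposition. *)
Lemma induced_fixed_point :
  (forall g, exists2 q, Q q &
    forall k, k \in conj_subgroup Gamma H g -> act k q = q) ->
  exists2 f, induced_set Q act f & forall h, h \in H -> translate h f = f.
Proof.
case: actQ => stabQ act1 actM _ _ fixQ.
have /choice[q qP] g : exists q, Q q /\
    forall k, k \in conj_subgroup Gamma H g -> act k q = q.
  by have [q Qq qK] := fixQ g; exists q.
pose D (x r : G) := exists h, exists2 k : subgroup_type Gamma,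
  h \in H & x = h * r * val k.
have Dxx x : D x x.
  by exists 1; exists 1; [exact: gpred1|rewrite mul1g val1 mulg1].
have DE x y : D y x -> D x = D y.
  move=> [h [k hH ->]]; apply/funext => r; apply/propext; split.
    move=> [h' [k' h'H ->]]; exists (h * h'); exists (k' * k).
      exact: gpredM.
    by rewrite valM !mulgA.
  move=> [h' [k' h'H e]]; exists (h^-1 * h'); exists (k' * k^-1).
    by apply: gpredM => //; rewrite gpredV.
  have -> : x = h^-1 * (h * x * val k) * (val k)^-1.
    by rewrite !mulgA mulVg mul1g mulgK.
  by rewrite e valM gmulfV !mulgA.
(* [xget 1 (D x)] depends only on the set [D x], hence only on the double coset
   of x. *)
pose r x := xget 1 (D x).
have rP x : D x (r x) by apply: (@xgetPex _ 1 (D x)); exists x.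
pose K x := [set k : subgroup_type Gamma |
  exists2 h, h \in H & x = h * r x * val k].
have KP x : K x (xget 1 (K x)).
  by apply: xgetPex; have [h [k hH e]] := rP x; exists k; exists h.
pose f : function_space G E := fun x => act (xget 1 (K x))^-1 (q (r x)).
(* One identity serves twice: h = 1 gives equivariance under [Gamma], and k = 1 gives invariance
   under [H]. *)
have fE h x k : h \in H -> f (h * x * val k) = act k^-1 (f x).
  move=> hH; rewrite /f.
  set y := h * x * val k.
  have rE : r y = r x by rewrite /r (DE x y)//; exists h; exists k.
  rewrite rE.
  have [h1 h1H e1] := KP x; have [h2 h2H e2] := KP y.
  move: (xget _ _) (xget _ _) e1 e2 => k2 k1 e1 e2.
  have [Qq qK] := qP (r x).
  rewrite -actM// -invgM.
  (* With x = h1 r k1 and h x k = h2 r k2, the element k1 k k2^-1 is conjugated by r to h1^-1 h^-1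
     h2, hence fixes the chosen point. *)
  rewrite -[in RHS](qK (k1 * k * k2^-1)).
    by rewrite -actM// mulKg.
  rewrite inE !valM gmulfV.
  have -> : r x * (val k1 * val k * (val k2)^-1) * (r x)^-1 =
      (h1^-1 * h^-1) * h2.
    have -> : val k2 = (h2 * r x)^-1 * y.
      by rewrite [in RHS]e2 rE mulKg.
    have -> : val k1 = (h1 * r x)^-1 * x.
      by rewrite [X in _ = _ * X]e1 mulKg.
    by rewrite /y !invgM !invgK !mulgA mulgV mul1g !mulgK.
  by apply: gpredM => //; apply: gpredM; rewrite gpredV.
exists f => [|h hH].
  split=> [x|x k]; last by rewrite -[x]mul1g fE ?gpred1// mul1g.
  by apply: stabQ; have [] := qP (r x).
apply/funext => x; rewrite /translate -[h^-1 * x]mulg1.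
have -> : (1 : G) = val (1 : subgroup_type Gamma) by rewrite val1.
rewrite fE ?gpredV// invg1 act1//.
by apply: stabQ; have [] := qP (r x).
Qed.

End InducedFixedPoint.

Theorem theorem7 (R : realType) (G : topologicalGroupType)
    (H Gamma : groupClosed G) :
  locally_compact_group G ->
  open [set` H] ->
  hecke_pair H ->
  closed [set` Gamma] ->
  {subset H <= Gamma} ->
  amenable_pair R H ->
  amenable_pair R (subgroup_in Gamma H).
Proof.
move=> _ openH heckeH _ HGamma amenH E Q act hausE cptQ cvxQ actQ [x Qx xH].
have hausF : hausdorff_space (function_space G E).
  exact: (@hausdorff_product G (fun=> E) (fun=> hausE)).
have [f If fH] : exists2 f, induced_set Q act f &
    forall h, h \in H -> translate h f = f.
  apply: (induced_fixed_point actQ) => g.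
  apply: (finite_orbit_fixed cvxQ actQ Qx).
  exact: (hecke_finite_orbit heckeH actQ).
have [f0 [Qf0 ef0] f0G] := amenH _ _ _ hausF (induced_compact actQ hausE cptQ)
  (induced_convex actQ cvxQ) (translate_action HGamma actQ openH)
  (ex_intro2 _ _ f If fH).
(* By equivariance [act k (f0 1)] is the value of [f0] at k^-1, which is the value at 1 of the
   translate of [f0] by k, that is, of [f0] itself. *)
exists (f0 1%g) => // k.
rewrite -[in LHS](invgK k) -ef0 -[in RHS](f0G (val k)) /translate.
by rewrite mul1g mulg1 gmulfV.
Qed.
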